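(* Let $R$ be a commutative ring and let $S\subseteq R$ be a multiplicative system. For all $k,n$ with $1\leq k\leq n\leq \infty$, the map $K(R\text{ on }S,k)\to K(R\text{ on }S,n)$ induced by the inclusion $\mathcal{P}(R,k)\hookrightarrow \mathcal{P}(R,n)$ is an isomorphism.
   Context: All chain complexes vanish in negative degrees. $\mathcal{P}(R)$ denotes the category of bounded chain complexes $P_\bullet$ of $R$-modules such that $P_i=0$ for $i<0$ and each $P_i$ is a finitely-generated projective $R$-module. For an integer $n\geq 0$, $\mathcal{P}(R,n)$ is the full subcategory of $\mathcal{P}(R)$ consisting of complexes with $P_i=0$ for $i\notin[0,n]$; also $\mathcal{P}(R,\infty)=\mathcal{P}(R)$. For $0\leq n\leq\infty$, $K(R\text{ on }S,n)$ is the quotient of the free abelian group on the isomorphism classes of objects $P_\bullet$ of $\mathcal{P}(R,n)$ such that $S^{-1}P_\bullet$ is exact, by the relations: (1) $[P_\bullet]=[P'_\bullet]+[P''_\bullet]$ whenever $0\to P'_\bullet\to P_\bullet\to P''_\bullet\to 0$ is a short exact sequence of such complexes; (2) $[P_\bullet]=0$ if $H_*(P_\bullet)=0$. *)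

(* Defs.v *)
From HB Require Import structures.
From mathcomp Require Import all_boot all_order all_algebra.
From mathcomp Require Import boolp ring.

Set Implicit Arguments.
Unset Strict Implicit.
Unset Printing Implicit Defensive.

Import GRing.Theory.
Local Open Scope ring_scope.
Local Open Scope quotient_scope.

(* The category of complexes is a proper class, so the groups below do not fit
   in the universe that MathComp allots to the carriers of its choiceType-based
   hierarchy: [zmodType], [{freeg _}] and [{quot _}] cannot be applied to them.
   Quotients of large types and abelian groups without a choice structure are
   therefore introduced first. *)

Definition quo (T : Type) (E : T -> T -> Prop) : Type :=
  {c : T -> Prop | exists x, c = E x}.

Definition cls (T : Type) (E : T -> T -> Prop) (x : T) : quo E :=
  exist _ (E x) (ex_intro _ x erefl).
Arguments cls {T} E x.

Record eqv_rel (T : Type) (E : T -> T -> Prop) : Prop := {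
  erel_refl : forall x, E x x;
  erel_sym : forall x y, E x y -> E y x;
  erel_trans : forall x y z, E x y -> E y z -> E x z }.

Section QuoTheory.
Variables (T : Type) (E : T -> T -> Prop).

Lemma quo_eq (p q : quo E) : sval p = sval q -> p = q.
Proof.
case: p q => [c hc] [d hd] /= cd; move: cd hc hd => -> hc hd.
by rewrite (Prop_irrelevance hc hd).
Qed.

Lemma cls_surj (q : quo E) : exists x, q = cls E x.
Proof. by case: (svalP q) => x ex; exists x; exact: quo_eq. Qed.

Lemma clsP : eqv_rel E -> forall x y, cls E x = cls E y <-> E x y.
Proof.
move=> [r s t] x y; split=> [/(congr1 (@sval _ _)) /= ->|xy]; first exact: r.
apply: quo_eq; apply: funext => z; apply: propext; split; last exact: t.
by apply: t; apply: s.
Qed.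

Definition rpr (q : quo E) : T := sval (cid (cls_surj q)).

Lemma rprK q : cls E (rpr q) = q.
Proof. by rewrite /rpr; case: (cid _). Qed.

Definition quo_lift (U : Type) (f : T -> U) (q : quo E) : U := f (rpr q).

Lemma quo_liftE (U : Type) (f : T -> U) x : eqv_rel E ->
  (forall x y, E x y -> f x = f y) -> quo_lift f (cls E x) = f x.
Proof. by move=> eqE fE; apply: fE; apply/(clsP eqE); rewrite rprK. Qed.

End QuoTheory.

Record abGroup := AbGroup {
  ag_car :> Type;
  ag0 : ag_car;
  agN : ag_car -> ag_car;
  agD : ag_car -> ag_car -> ag_car;
  agDA : associative agD;
  agDC : commutative agD;
  ag0D : left_id ag0 agD;
  agND : left_inverse ag0 agN agD }.
Arguments ag0 {_}.

Record abHom (G H : abGroup) := AbHom {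
  ah_fun :> G -> H;
  ah_D : forall x y, ah_fun (agD x y) = agD (ah_fun x) (ah_fun y) }.

Definition abIso (G H : abGroup) (f : abHom G H) : Prop :=
  exists g : abHom H G, cancel f g /\ cancel g f.

Section AbTheory.
Variable G : abGroup.
Implicit Types x y z t : G.

Lemma agD0 x : agD x ag0 = x. Proof. by rewrite agDC ag0D. Qed.
Lemma agDN x : agD x (agN x) = ag0. Proof. by rewrite agDC agND. Qed.

Lemma agD_inj x y z : agD x y = agD x z -> y = z.
Proof.
by move=> /(congr1 (agD (agN x))); rewrite !agDA !agND !ag0D.
Qed.

Lemma agN_uniq x y : agD x y = ag0 -> y = agN x.
Proof. by move=> xy; apply: (@agD_inj x); rewrite xy agDN. Qed.

Lemma agNK x : agN (agN x) = x.
Proof. by apply/esym/agN_uniq; rewrite agND. Qed.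

Lemma agDACA x y z t : agD (agD x y) (agD z t) = agD (agD x z) (agD y t).
Proof. by rewrite !agDA -(agDA x y) (agDC y) agDA. Qed.

Lemma agN0 : agN ag0 = ag0 :> G.
Proof. by apply/esym/agN_uniq; rewrite ag0D. Qed.

Lemma agND2 x y : agN (agD x y) = agD (agN x) (agN y).
Proof. by apply/esym/agN_uniq; rewrite agDACA !agDN ag0D. Qed.

Lemma agB_eq0 x y : agD x (agN y) = ag0 -> x = y.
Proof. by rewrite agDC => /agN_uniq ->; rewrite agNK. Qed.

End AbTheory.

Lemma ah_0 (G H : abGroup) (f : abHom G H) : f ag0 = ag0.
Proof. by apply: (@agD_inj _ (f ag0)); rewrite -ah_D ag0D agD0. Qed.

Lemma ah_N (G H : abGroup) (f : abHom G H) x : f (agN x) = agN (f x).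
Proof. by apply: agN_uniq; rewrite -ah_D agDN ah_0. Qed.

Section FreeAb.
Variable X : Type.

Inductive fterm :=
  | FGen of X
  | FZero
  | FOpp of fterm
  | FAdd of fterm & fterm.

Inductive feq : fterm -> fterm -> Prop :=
  | feq_refl a : feq a a
  | feq_sym a b : feq a b -> feq b a
  | feq_trans a b c : feq a b -> feq b c -> feq a c
  | feq_opp a b : feq a b -> feq (FOpp a) (FOpp b)
  | feq_add a b c d : feq a b -> feq c d -> feq (FAdd a c) (FAdd b d)
  | feq_addA a b c : feq (FAdd a (FAdd b c)) (FAdd (FAdd a b) c)
  | feq_addC a b : feq (FAdd a b) (FAdd b a)
  | feq_add0 a : feq (FAdd FZero a) a
  | feq_addN a : feq (FAdd (FOpp a) a) FZero.

Lemma feq_equiv : eqv_rel feq.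
Proof.
by split; [exact: feq_refl | exact: feq_sym | exact: feq_trans].
Qed.

Let fr := quo feq.
Let fr0 : fr := cls feq FZero.
Let frN (a : fr) : fr := quo_lift (fun t => cls feq (FOpp t)) a.
Let frD (a b : fr) : fr :=
  quo_lift (fun t => quo_lift (fun u => cls feq (FAdd t u)) b) a.

Let frNE t : frN (cls feq t) = cls feq (FOpp t).
Proof.
apply: quo_liftE feq_equiv _ => x y xy; apply/(clsP feq_equiv).
exact: feq_opp.
Qed.

Let frDE t u : frD (cls feq t) (cls feq u) = cls feq (FAdd t u).
Proof.
have E a b : quo_lift (fun u => cls feq (FAdd a u)) (cls feq b) =
             cls feq (FAdd a b).
  apply: quo_liftE feq_equiv _ => x y xy; apply/(clsP feq_equiv).
  exact: feq_add (feq_refl _) xy.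
rewrite /frD quo_liftE ?E //; first exact: feq_equiv.
move=> x y xy; rewrite !E; apply/(clsP feq_equiv).
exact: feq_add xy (feq_refl _).
Qed.

Let frDA : associative frD.
Proof.
move=> x y z; have [a ->] := cls_surj x; have [b ->] := cls_surj y.
have [c ->] := cls_surj z; rewrite !frDE; apply/(clsP feq_equiv).
exact: feq_addA.
Qed.

Let frDC : commutative frD.
Proof.
move=> x y; have [a ->] := cls_surj x; have [b ->] := cls_surj y.
by rewrite !frDE; apply/(clsP feq_equiv); exact: feq_addC.
Qed.

Let fr0D : left_id fr0 frD.
Proof.
move=> x; have [a ->] := cls_surj x; rewrite frDE; apply/(clsP feq_equiv).
exact: feq_add0.
Qed.

Let frND : left_inverse fr0 frN frD.
Proof.
move=> x; have [a ->] := cls_surj x; rewrite frNE frDE; apply/(clsP feq_equiv).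
exact: feq_addN.
Qed.

Definition freeAb : abGroup := AbGroup frDA frDC fr0D frND.

Definition fgen (x : X) : freeAb := cls feq (FGen x).

Lemma freeAb_ind (P : freeAb -> Prop) :
  (forall x, P (fgen x)) -> P ag0 -> (forall a, P a -> P (agN a)) ->
  (forall a b, P a -> P b -> P (agD a b)) -> forall a, P a.
Proof.
move=> Pg P0 PN PD a; have [t ->] := cls_surj a.
elim: t => [x||t IHt|t IHt u IHu]; [exact: Pg | exact: P0 | |].
  by have := PN _ IHt; rewrite /= frNE.
by have := PD _ _ IHt IHu; rewrite /= frDE.
Qed.

Section Lift.
Variables (G : abGroup) (f : X -> G).

Fixpoint feval (t : fterm) : G := match t with
  | FGen x => f x
  | FZero => ag0
  | FOpp t => agN (feval t)
  | FAdd t u => agD (feval t) (feval u)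
  end.

Lemma feval_feq t u : feq t u -> feval t = feval u.
Proof.
elim=> {t u} //= [a b c _ -> //|a b _ ->|a b c d _ -> _ -> //|a b c|a b|a|a] //.
- exact: agDA.
- exact: agDC.
- exact: ag0D.
- exact: agND.
Qed.

Let flE t : quo_lift feval (cls feq t) = feval t.
Proof. exact: quo_liftE feq_equiv feval_feq. Qed.

Let flD (x y : freeAb) :
  quo_lift feval (agD x y) = agD (quo_lift feval x) (quo_lift feval y).
Proof.
have [a ->] := cls_surj x; have [b ->] := cls_surj y.
by rewrite /= frDE !flE.
Qed.

Definition freeAb_lift : abHom freeAb G :=
  @AbHom freeAb G (quo_lift feval) flD.

Lemma freeAb_liftE x : freeAb_lift (fgen x) = f x.
Proof. exact: flE. Qed.

Lemma freeAb_lift_uniq (h : abHom freeAb G) :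
  (forall x, h (fgen x) = f x) -> forall a, h a = freeAb_lift a.
Proof.
move=> hf; elim/freeAb_ind => [x||a IH|a b IHa IHb].
- by rewrite freeAb_liftE.
- by rewrite !ah_0.
- by rewrite !ah_N IH.
- by rewrite !ah_D IHa IHb.
Qed.

End Lift.
End FreeAb.

Section QuotAb.
Variables (G : abGroup) (r : G -> Prop).

Inductive ag_span : G -> Prop :=
  | span_gen x : r x -> ag_span x
  | span0 : ag_span ag0
  | spanN x : ag_span x -> ag_span (agN x)
  | spanD x y : ag_span x -> ag_span y -> ag_span (agD x y).

Definition qrel (x y : G) : Prop := ag_span (agD x (agN y)).

Lemma qrel_equiv : eqv_rel qrel.
Proof.
split=> [x|x y|x y z]; rewrite /qrel; first by rewrite agDN; exact: span0.
  by move=> /spanN; rewrite agND2 agNK agDC.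
move=> /spanD h /h; rewrite agDA -[agD (agD x _) y]agDA agND.
by rewrite [agD x ag0]agDC ag0D.
Qed.

Let qt := quo qrel.
Let qt0 : qt := cls qrel ag0.
Let qtN (a : qt) : qt := quo_lift (fun t => cls qrel (agN t)) a.
Let qtD (a b : qt) : qt :=
  quo_lift (fun t => quo_lift (fun u => cls qrel (agD t u)) b) a.

Let qtNE t : qtN (cls qrel t) = cls qrel (agN t).
Proof.
apply: quo_liftE qrel_equiv _ => x y /spanN xy; apply/(clsP qrel_equiv).
by rewrite /qrel -agND2.
Qed.

Let qtDE t u : qtD (cls qrel t) (cls qrel u) = cls qrel (agD t u).
Proof.
have qD a b c d : qrel a b -> qrel c d -> qrel (agD a c) (agD b d).
  by move=> /spanD h /h; rewrite /qrel agND2 agDACA.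
have E a b : quo_lift (fun u => cls qrel (agD a u)) (cls qrel b) =
             cls qrel (agD a b).
  apply: quo_liftE qrel_equiv _ => x y xy; apply/(clsP qrel_equiv).
  exact: qD (erel_refl qrel_equiv _) xy.
rewrite /qtD quo_liftE ?E //; first exact: qrel_equiv.
move=> x y xy; rewrite !E; apply/(clsP qrel_equiv).
exact: qD xy (erel_refl qrel_equiv _).
Qed.

Let qtDA : associative qtD.
Proof.
move=> x y z; have [a ->] := cls_surj x; have [b ->] := cls_surj y.
by have [c ->] := cls_surj z; rewrite !qtDE agDA.
Qed.

Let qtDC : commutative qtD.
Proof.
move=> x y; have [a ->] := cls_surj x; have [b ->] := cls_surj y.
by rewrite !qtDE agDC.
Qed.

Let qt0D : left_id qt0 qtD.
Proof. by move=> x; have [a ->] := cls_surj x; rewrite qtDE ag0D. Qed.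

Let qtND : left_inverse qt0 qtN qtD.
Proof. by move=> x; have [a ->] := cls_surj x; rewrite qtNE qtDE agND. Qed.

Definition quotAb : abGroup := AbGroup qtDA qtDC qt0D qtND.

Let qprojD (x y : G) :
  cls qrel (agD x y) = agD (cls qrel x : quotAb) (cls qrel y).
Proof. by rewrite /= qtDE. Qed.

Definition qproj : abHom G quotAb := @AbHom G quotAb (cls qrel) qprojD.

Lemma qproj_surj (q : quotAb) : exists x, q = qproj x.
Proof. exact: cls_surj. Qed.

Lemma qprojP x y : qproj x = qproj y <-> ag_span (agD x (agN y)).
Proof. exact: clsP qrel_equiv x y. Qed.

Lemma qproj_rel x : r x -> qproj x = ag0.
Proof.
move=> rx; rewrite -[RHS](ah_0 qproj); apply/qprojP.
by rewrite agN0 agD0; exact: span_gen.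
Qed.

Section Lift.
Variables (H : abGroup) (f : abHom G H) (fr : forall x, r x -> f x = ag0).

Lemma span_ker x : ag_span x -> f x = ag0.
Proof.
elim=> {x} [x /fr //||x _ IH|x y _ IHx _ IHy].
- exact: ah_0.
- by rewrite ah_N IH agN0.
- by rewrite ah_D IHx IHy ag0D.
Qed.

Let qlE x : quo_lift f (cls qrel x) = f x.
Proof.
apply: quo_liftE qrel_equiv _ => y z /span_ker.
by rewrite ah_D ah_N; exact: agB_eq0.
Qed.

Let qlD (x y : quotAb) :
  quo_lift f (agD x y) = agD (quo_lift f x) (quo_lift f y).
Proof.
have [a ->] := cls_surj x; have [b ->] := cls_surj y.
by rewrite /= qtDE !qlE ah_D.
Qed.

Definition quotAb_lift : abHom quotAb H :=
  @AbHom quotAb H (quo_lift f) qlD.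

Lemma quotAb_liftE x : quotAb_lift (qproj x) = f x.
Proof. exact: qlE. Qed.

End Lift.
End QuotAb.

(* [loc S M] is the localization S^-1 M, on pairs (m, s) representing m / s.
   S may contain zero divisors, or even 0. It is kept as an R-module, which is
   all that exactness of a localized complex depends on. *)
Section Localization.
Variables (R : comPzRingType) (S : mulrClosed R).

Definition denom : Type := {s : R | s \in S}.
HB.instance Definition _ := Choice.on denom.

Definition dval (s : denom) : R := val s.

Lemma denomM_subproof (s t : denom) : dval s * dval t \in S.
Proof. exact: rpredM (valP s) (valP t). Qed.

Definition denomM (s t : denom) : denom := 
  exist _ (dval s * dval t) (denomM_subproof s t).
Definition denom1 : denom := exist _ 1 (rpred1 S).

Lemma dvalM s t : dval (denomM s t) = dval s * dval t.
Proof. by []. Qed.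

Lemma dval1 : dval denom1 = 1.
Proof. by []. Qed.

Section Module.
Variable M : lmodType R.

Definition loc_equiv (x y : M * denom) : bool :=
  `[< exists t : denom,
        dval t *: (dval y.2 *: x.1 - dval x.2 *: y.1) = 0 >].

Lemma loc_equivP x y : reflect
  (exists t : denom, (dval t * dval y.2) *: x.1 = (dval t * dval x.2) *: y.1)
  (loc_equiv x y).
Proof.
apply: (iffP (asboolP _)) => -[t e]; exists t.
  by apply/eqP; rewrite -subr_eq0 -!scalerA -scalerBr e.
by rewrite scalerBr !scalerA e subrr.
Qed.

Lemma loc_equiv_is_equiv : equiv_class_of loc_equiv.
Proof.
split=> [x|x y|y x z].
- by apply/loc_equivP; exists denom1.
- by apply/loc_equivP/loc_equivP => -[t e]; exists t.
- move=> /loc_equivP[t e] /loc_equivP[u f]; apply/loc_equivP.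
  exists (denomM (denomM t u) y.2) ; rewrite !dvalM.
  have -> : dval t * dval u * dval y.2 * dval z.2 =
            dval u * dval z.2 * (dval t * dval y.2) by ring.
  rewrite -scalerA e scalerA.
  have -> : dval u * dval z.2 * (dval t * dval x.2) =
            dval t * dval x.2 * (dval u * dval z.2) by ring.
  by rewrite -scalerA f scalerA; congr (_ *: _); ring.
Qed.

Canonical loc_equivR := EquivRelPack loc_equiv_is_equiv.
Canonical loc_encModRel := defaultEncModRel loc_equiv.

Definition loc : Type := {eq_quot loc_equiv}.
HB.instance Definition _ := Choice.on loc.
HB.instance Definition _ := EqQuotient.on loc.

Definition frac (m : M) (s : denom) : loc := \pi_loc (m, s).

Lemma fracP m s m' s' : frac m s = frac m' s' <->
  exists t : denom, (dval t * dval s') *: m = (dval t * dval s) *: m'.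
Proof.
rewrite /frac; split=> [/eqquotP/loc_equivP //|e].
by apply/eqquotP/loc_equivP.
Qed.

Lemma frac_eq m s m' s' : dval s' *: m = dval s *: m' -> frac m s = frac m' s'.
Proof. by move=> e; apply/fracP; exists denom1; rewrite dval1 !mul1r. Qed.

Lemma frac_surj x : exists m s, x = frac m s.
Proof. by elim/quotW: x => -[m s]; exists m, s. Qed.

Definition loc0 : loc := frac 0 denom1.
Definition locD (x y : loc) : loc :=
  frac (dval (repr y).2 *: (repr x).1 + dval (repr x).2 *: (repr y).1)
       (denomM (repr x).2 (repr y).2).
Definition locN (x : loc) : loc := frac (- (repr x).1) (repr x).2.
Definition locZ (a : R) (x : loc) : loc := frac (a *: (repr x).1) (repr x).2.

Lemma repr_frac m s : exists t : denom,
  (dval t * dval s) *: (repr (frac m s)).1 =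
  (dval t * dval (repr (frac m s)).2) *: m.
Proof.
apply/fracP; rewrite /frac -surjective_pairing reprK //.
Qed.

Lemma locDE m s n t :
  locD (frac m s) (frac n t) = frac (dval t *: m + dval s *: n) (denomM s t).
Proof.
rewrite /locD; have [u em] := repr_frac m s; have [v en] := repr_frac n t.
case: (repr (frac m s)) em => m' s' em; case: (repr (frac n t)) en => n' t' en.
apply/fracP; exists (denomM u v); rewrite /= in em en *; rewrite !dvalM !scalerDr !scalerA; congr (_ + _).
  have -> : dval u * dval v * (dval s * dval t) * dval t' =
            dval v * dval t * dval t' * (dval u * dval s) by ring.
  by rewrite -scalerA em scalerA; congr (_ *: _); ring.
have -> : dval u * dval v * (dval s * dval t) * dval s' =
          dval u * dval s * dval s' * (dval v * dval t) by ring.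
by rewrite -scalerA en scalerA; congr (_ *: _); ring.
Qed.

Lemma locNE m s : locN (frac m s) = frac (- m) s.
Proof.
rewrite /locN; have [u e] := repr_frac m s; apply/fracP; exists u.
by rewrite !scalerN e.
Qed.

Lemma locZE a m s : locZ a (frac m s) = frac (a *: m) s.
Proof.
rewrite /locZ; have [u e] := repr_frac m s; apply/fracP; exists u.
by rewrite !scalerA ![_ * a]mulrC -[LHS]scalerA e scalerA.
Qed.

Lemma locDA : associative locD.
Proof.
move=> x y z; have [m [s ->]] := frac_surj x; have [n [t ->]] := frac_surj y.
have [p [u ->]] := frac_surj z; rewrite !locDE; apply: frac_eq; rewrite !dvalM.
rewrite !scalerDr !scalerA addrA.
by congr (_ *: _ + _ *: _ + _ *: _); ring.
Qed.

Lemma locDC : commutative locD.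
Proof.
move=> x y; have [m [s ->]] := frac_surj x; have [n [t ->]] := frac_surj y.
by rewrite !locDE; apply: frac_eq; rewrite !dvalM addrC mulrC.
Qed.

Lemma loc0D : left_id loc0 locD.
Proof.
move=> x; have [m [s ->]] := frac_surj x; rewrite locDE; apply: frac_eq.
by rewrite !dvalM dval1 scaler0 add0r scalerA mulrC.
Qed.

Lemma locND : left_inverse loc0 locN locD.
Proof.
move=> x; have [m [s ->]] := frac_surj x; rewrite locNE locDE.
by apply: frac_eq; rewrite scalerN addNr !scaler0.
Qed.

HB.instance Definition _ := GRing.isZmodule.Build loc locDA locDC loc0D locND.

Let locZA a b x : locZ a (locZ b x) = locZ (a * b) x.
Proof. by have [m [s ->]] := frac_surj x; rewrite !locZE scalerA. Qed.

Let loc1Z : left_id 1 locZ.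
Proof. by move=> x; have [m [s ->]] := frac_surj x; rewrite locZE scale1r. Qed.

Let locZDr : right_distributive locZ +%R.
Proof.
move=> a x y; have [m [s ->]] := frac_surj x; have [n [t ->]] := frac_surj y.
rewrite [_ + _]locDE !locZE [RHS]locDE; congr frac.
by rewrite scalerDr !scalerA ![a * _]mulrC.
Qed.

Let locZDl x : {morph locZ^~ x : a b / a + b}.
Proof.
move=> a b; have [m [s ->]] := frac_surj x.
rewrite !locZE [RHS]locDE; apply: frac_eq.
by rewrite !dvalM -scalerDr -scalerDl !scalerA; congr (_ *: _); ring.
Qed.

HB.instance Definition _ := GRing.Zmodule_isLmodule.Build R loc
  locZA loc1Z locZDr locZDl.

Lemma fracD m s n t :
  frac m s + frac n t = frac (dval t *: m + dval s *: n) (denomM s t).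
Proof. exact: locDE. Qed.

Lemma fracZ a m s : a *: frac m s = frac (a *: m) s.
Proof. exact: locZE. Qed.

Lemma frac0 s : frac 0 s = 0.
Proof. by apply: frac_eq; rewrite !scaler0. Qed.

End Module.

Section Map.
Variables (M N : lmodType R) (f : {linear M -> N}).

Definition loc_map (x : loc M) : loc N := frac (f (repr x).1) (repr x).2.

Lemma loc_mapE m s : loc_map (frac m s) = frac (f m) s.
Proof.
rewrite /loc_map; have [u e] := repr_frac m s; apply/fracP; exists u.
by rewrite -!linearZ e.
Qed.

Let loc_map_linear : linear loc_map.
Proof.
move=> a x y; have [m [s ->]] := frac_surj x; have [n [t ->]] := frac_surj y.
by rewrite fracZ fracD !loc_mapE fracZ fracD linearD !(linearZ_LR f).
Qed.

HB.instance Definition _ :=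
  GRing.isLinear.Build R (loc M) (loc N) *:%R loc_map loc_map_linear.

End Map.
End Localization.

Arguments loc_map {R} S {M N} f x.

Section Complexes.
Variable R : comPzRingType.

Record cplx := Cplx {
  cobj :> nat -> lmodType R;
  cdiff : forall i, {linear cobj i.+1 -> cobj i};
  cdiffK : forall i x, cdiff i (cdiff i.+1 x) = 0 }.

Implicit Types P Q : cplx.

Definition is_cycle P (i : nat) : P i -> Prop :=
  match i return P i -> Prop with
  | 0 => fun=> True
  | j.+1 => fun x => cdiff P j x = 0
  end.

Definition is_boundary P (i : nat) (x : P i) : Prop :=
  exists y, cdiff P i y = x.

(* As P vanishes in negative degrees, every element of degree 0 is a cycle, so
   acyclicity includes surjectivity of P_1 -> P_0. *)
Definition acyclic P : Prop :=
  forall i (x : P i), is_cycle x -> is_boundary x.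

Record cmap P Q := CMap {
  cmap_fun :> forall i, {linear P i -> Q i};
  cmapd : forall i x, cdiff Q i (cmap_fun i.+1 x) = cmap_fun i (cdiff P i x) }.

Definition ciso P Q : Prop := exists (f : cmap P Q) (g : cmap Q P),
  forall i, cancel (f i) (g i) /\ cancel (g i) (f i).

Lemma ciso_equiv : eqv_rel ciso.
Proof.
split=> [P|P Q [f [g fg]]|P Q T [f [g fg]] [h [k hk]]].
- pose i : cmap P P := @CMap P P (fun i => idfun) (fun _ _ => erefl).
  by exists i, i.
- by exists g, f => i; have [] := fg i.
- have hfd i x : cdiff T i ((h i.+1 \o f i.+1) x) = (h i \o f i) (cdiff P i x).
    by rewrite /= !cmapd.
  have gkd i x : cdiff P i ((g i.+1 \o k i.+1) x) = (g i \o k i) (cdiff T i x).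
    by rewrite /= !cmapd.
  exists (@CMap P T (fun i => h i \o f i) hfd).
  exists (@CMap T P (fun i => g i \o k i) gkd) => i /=.
  have [fK gK] := fg i; have [hK kK] := hk i.
  by split=> x /=; rewrite ?hK ?fK ?gK ?kK.
Qed.


Definition short_exact P' P P'' (f : cmap P' P) (g : cmap P P'') : Prop :=
  forall i, [/\ injective (f i), (forall z, exists y, g i y = z) &
    forall y, g i y = 0 <-> exists x, f i x = y].

Definition zero_module (M : lmodType R) : Prop := forall x : M, x = 0.

Definition fin_gen (M : lmodType R) : Prop :=
  exists (n : nat) (e : 'I_n -> M),
    forall x, exists c : 'I_n -> R, x = \sum_(i < n) c i *: e i.

Definition projective (M : lmodType R) : Prop :=
  forall (A B : lmodType R) (g : {linear A -> B}) (f : {linear M -> B}),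
    (forall b, exists a, g a = b) ->
    exists h : {linear M -> A}, forall x, g (h x) = f x.

Section LocCplx.
Variables (S : mulrClosed R) (P : cplx).

Let loc_cdiffK i x : loc_map S (cdiff P i) (loc_map S (cdiff P i.+1) x) = 0.
Proof.
by have [m [s ->]] := frac_surj x; rewrite !loc_mapE cdiffK frac0.
Qed.

Definition loc_cplx : cplx :=
  @Cplx (fun i => loc S (P i)) (fun i => loc_map S (cdiff P i)) loc_cdiffK.
End LocCplx.

End Complexes.

Inductive natinf := Fin of nat | Infty.
Coercion Fin : nat >-> natinf.

Definition lei (k n : natinf) : bool := match k, n with
  | _, Infty => true
  | Fin k, Fin n => (k <= n)%N
  | Infty, Fin _ => false
  end.

Lemma lei_trans k n m : lei k n -> lei n m -> lei k m.
Proof. by case: k n m => [k|] [n|] [m|] //=; exact: leq_trans. Qed.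

Section Kgroups.
Variables (R : comPzRingType) (S : mulrClosed R).

(* The complexes of P(R, n) whose localization at S is exact. *)
Record Kcplx_spec (n : natinf) (P : cplx R) : Prop := {
  Kbounded : exists N : nat, forall i, (N < i)%N -> zero_module (P i);
  Krange : forall i : nat, ~~ lei i n -> zero_module (P i);
  Kfin_gen : forall i, fin_gen (P i);
  Kprojective : forall i, projective (P i);
  Kloc_exact : acyclic (loc_cplx S P) }.

Record Kcplx (n : natinf) := MkKcplx {
  Kcplx_cplx :> cplx R;
  KcplxP : Kcplx_spec n Kcplx_cplx }.

Definition Kciso n (P Q : Kcplx n) : Prop := ciso P Q.

Lemma Kciso_equiv n : eqv_rel (@Kciso n).
Proof.
have [r s t] := ciso_equiv R.
split=> [P|P Q|P Q T]; [exact: r | exact: s | exact: t].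
Qed.

Definition iso_class n : Type := quo (@Kciso n).

Definition Kfree n : abGroup := freeAb (iso_class n).

Definition fclass n (P : Kcplx n) : Kfree n := fgen (cls (@Kciso n) P).

Inductive Krel n : Kfree n -> Prop :=
  | Krel_exact (P' P P'' : Kcplx n) (f : cmap P' P) (g : cmap P P'') :
      short_exact f g ->
      Krel (agD (fclass P) (agN (agD (fclass P') (fclass P''))))
  | Krel_acyclic (P : Kcplx n) : acyclic P -> Krel (fclass P).

Definition Kgroup n : abGroup := quotAb (@Krel n).

Definition Kclass n (P : Kcplx n) : Kgroup n := qproj (@Krel n) (fclass P).

Section Inclusion.
Variables (k n : natinf) (kn : lei k n).

Lemma Kincl_subproof (P : Kcplx k) : Kcplx_spec n P.
Proof.
case: (KcplxP P) => b r f p l; split=> // i i_n; apply: r.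
by apply: contra i_n => /lei_trans; exact.
Qed.

Definition Kincl (P : Kcplx k) : Kcplx n := MkKcplx (Kincl_subproof P).

Definition iso_class_incl : iso_class k -> iso_class n :=
  quo_lift (fun P => cls (@Kciso n) (Kincl P)).

Lemma iso_class_inclE P :
  iso_class_incl (cls (@Kciso k) P) = cls (@Kciso n) (Kincl P).
Proof.
apply: quo_liftE; first exact: Kciso_equiv.
by move=> {}P Q PQ; apply/(clsP (Kciso_equiv n)).
Qed.

Definition Kfree_map : abHom (Kfree k) (Kgroup n) :=
  freeAb_lift (fun c => qproj (@Krel n) (fgen (iso_class_incl c))).

Lemma Kfree_mapE P : Kfree_map (fclass P) = Kclass (Kincl P).
Proof. by rewrite /Kfree_map freeAb_liftE iso_class_inclE. Qed.

Lemma Kfree_map_rel x : Krel x -> Kfree_map x = ag0.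
Proof.
case=> [P' P P'' f g fg|P aP].
  have /qproj_rel <- := @Krel_exact n (Kincl P') (Kincl P) (Kincl P'') f g fg.
  by rewrite !(ah_D, ah_N) !Kfree_mapE.
have /qproj_rel <- := @Krel_acyclic n (Kincl P) aP.
by rewrite Kfree_mapE.
Qed.

Definition Kmap : abHom (Kgroup k) (Kgroup n) := quotAb_lift Kfree_map_rel.

Lemma KmapE P : Kmap (Kclass P) = Kclass (Kincl P).
Proof.
by rewrite /Kmap /Kclass quotAb_liftE ?Kfree_mapE //; exact: Kfree_map_rel.
Qed.

End Inclusion.
End Kgroups.

Arguments Kgroup {R} S n.
Arguments Kmap {R} S {k n} kn.

(* Main.v *)
From HB Require Import structures.
Require Import Defs.
From mathcomp Require Import all_boot all_order all_algebra.
From mathcomp Require Import boolp.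

Set Implicit Arguments.
Unset Strict Implicit.
Unset Printing Implicit Defensive.

Import GRing.Theory.
Local Open Scope ring_scope.

(* It suffices to invert K(m) -> K(m+1) for finite m >= 1, because every complex
   is bounded. As H_0(P) is S-torsion, some s in S admits h : P_0 -> P_1 with
   d h = s. The complex fold h : ... -> P_3 -> P_2 (+) P_0 -> P_1, with
   differential (- d, h) in degree 1, is one shorter than P, and an extension of
   P by it maps onto the complex s : P_0 -> P_0 with contractible kernel; no
   range larger than that of P is used. Hence
     P |-> [s : P_0 -> P_0] - [fold h]
   is the required inverse as soon as it is well defined. Two choices of h for
   the same s become homotopic after multiplication by some t in S, and replacing
   (s, h) by (t s, t h) adds [t : P_0 -> P_0] to both terms. For acyclic P one
   takes s = 1. On a short exact sequence, choices with a common s for the ends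
   give a compatible choice with s^2 in the middle. *)

(** * Finitely generated projective modules and lifting of maps out of them *)

Section Modules.
Variable R : comPzRingType.
Implicit Types A B C M N : lmodType R.

Section Pairing.
Variables (A B C : lmodType R) (f : {linear A -> B}) (g : {linear A -> C}).

Definition lpair_fun x := (f x, g x).

Lemma lpair_is_linear : linear lpair_fun.
Proof. by move=> a x y; rewrite /lpair_fun !linearP. Qed.

HB.instance Definition _ :=
  GRing.isLinear.Build R A (B * C)%type *:%R lpair_fun lpair_is_linear.

Definition lpair : {linear A -> (B * C)%type} := lpair_fun.

End Pairing.

Definition fgproj M := fin_gen M /\ projective M.

Lemma fgproj0 : fgproj 'rV[R]_0.
Proof.
split; first by exists 0, (fun=> 0) => x; exists (fun=> 0); rewrite big_ord0 thinmx0.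
move=> A B g f gS; exists \0 => x /=.
by rewrite !raddf0 thinmx0 raddf0.
Qed.

Lemma fgproj_prod M N : fgproj M -> fgproj N -> fgproj (M * N)%type.
Proof.
move=> [[m [e eM]] pM] [[n [e' eN]] pN]; split.
  exists (m + n)%N, (fun i => match split i with
    inl j => (e j, 0) | inr j => (0, e' j) end) => -[x y].
  have [c ->] := eM x; have [c' ->] := eN y.
  exists (fun i => match split i with inl j => c j | inr j => c' j end).
  rewrite big_split_ord /=.
  under [X in _ = X + _]eq_bigr => i _ do
    rewrite (unsplitK (inl i) : split (lshift n i) = _).
  under [X in _ = _ + X]eq_bigr => i _ do
    rewrite (unsplitK (inr i) : split (rshift m i) = _).
  rewrite [RHS]surjective_pairing; congr pair; rewrite raddfD /= !raddf_sum /=.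
    by rewrite [X in _ + X]big1 ?addr0 // => i _; rewrite scaler0.
  by rewrite [X in X + _]big1 ?add0r // => i _; rewrite scaler0.
move=> A B g f gS.
have [u uP] := pM A B g (f \o lpair idfun \0) gS.
have [v vP] := pN A B g (f \o lpair \0 idfun) gS.
exists ((u \o fst) \+ (v \o snd)) => -[x y] /=.
rewrite raddfD /= uP vP /= /lpair_fun /= -raddfD; congr (f _).
by apply/pair_equal_spec; rewrite /= addr0 add0r.
Qed.

(** Projectivity splits the surjection from a free module given by a finite generating family; [c]
    is the splitting. *)
Lemma fgproj_dual_basis M : fgproj M ->
  exists (n : nat) (e : 'I_n -> M) (c : {linear M -> 'rV[R]_n}),
    forall x, x = \sum_i c x 0 i *: e i.
Proof.
move=> [[n [e eM]] pM]; exists n, e.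
pose g (v : 'rV[R]_n) := \sum_i v 0 i *: e i.
have g_lin : linear g.
  move=> a u v; rewrite /g scaler_sumr -big_split /=; apply: eq_bigr => i _.
  by rewrite !mxE scalerDl scalerA.
pose gl := GRing.isLinear.Build R _ _ _ g g_lin.
pose gL : {linear 'rV[R]_n -> M} := HB.pack g gl.
have [|c cP] := pM _ _ gL idfun.
  move=> x; have [c ->] := eM x; exists (\row_i c i).
  by apply: eq_bigr => i _; rewrite mxE.
by exists c => x; rewrite -[LHS]cP.
Qed.

(** Preimages are chosen for the finitely many [f (e i)] and combined by dual-basis coordinates, so
    images and kernels never have to be made into modules. *)
Lemma fgproj_factor M A B (g : {linear A -> B}) (f : {linear M -> B}) :
  fgproj M -> (forall x, exists a, g a = f x) ->
  exists h : {linear M -> A}, forall x, g (h x) = f x.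
Proof.
move=> /fgproj_dual_basis[n [e [c cP]]] fg.
have [a aP] := choice (fun i => fg (e i)).
pose h x := \sum_i c x 0 i *: a i.
have h_lin : linear h.
  move=> r u v; rewrite /h scaler_sumr -big_split /=; apply: eq_bigr => i _.
  by rewrite linearP !mxE scalerDl scalerA.
pose hl := GRing.isLinear.Build R _ _ _ h h_lin.
exists (HB.pack h hl : {linear M -> A}) => x /=.
rewrite [in RHS](cP x) !linear_sum /=; apply: eq_bigr => i _.
by rewrite !linearZ aP.
Qed.

(** The denominators at the finitely many generators have a common multiple in [D], namely their
    product. *)
Lemma fgproj_factor_denom (D : {pred R}) M A B (g : {linear A -> B})
    (f : {linear M -> B}) : mulr_closed D ->
  fgproj M -> (forall x, exists2 t, t \in D & exists a, g a = t *: f x) ->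
  exists2 t, t \in D & exists h : {linear M -> A}, forall x, g (h x) = t *: f x.
Proof.
move=> [D1 DM] Mp fg.
have [n [e [c cP]]] := fgproj_dual_basis Mp.
have /choice[t tP] i : exists t, t \in D /\ exists a, g a = t *: f (e i).
  by have [t] := fg (e i); exists t.
have tD : \prod_i t i \in D by elim/big_ind: _ => // i _; have [] := tP i.
exists (\prod_i t i) => //.
have [|h hP] := @fgproj_factor M A B g ((\prod_i t i) \*: f) Mp.
  move=> x; pose r i := \prod_(j | j != i) t j.
  have [a aP] := choice (fun i => (tP i).2).
  (* The factor [r i] completes the denominator [t i] to the common product. *)
  exists (\sum_i (c x 0 i * r i) *: a i).
  rewrite /= [in RHS](cP x) !linear_sum /=; apply: eq_bigr => i _.
  rewrite !linearZ aP /= scalerA scalerA (bigD1 i) //= -/(r i).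
  by rewrite -mulrA [r i * _]mulrC.
by exists h.
Qed.

End Modules.

(** * Complexes with torsion homology: Koszul complexes, folds and extensions *)

Section ComplexConstructions.
Variable R : comPzRingType.
Implicit Types (M : lmodType R) (P Q : cplx R) (D : {pred R}).

(** With [D] the singleton of 1 this is exactness of [P], with [D = S] exactness of its
    localization; constructions are thus treated once for both. *)
Definition torsion_homology D P := forall i (x : P i), is_cycle x ->
  exists2 s, s \in D & is_boundary (s *: x).

Lemma acyclicP P : acyclic P <-> torsion_homology (pred1 1) P.
Proof.
split=> aP i x /aP => [bx|[s /eqP -> //]]; last by rewrite scale1r.
by exists 1; rewrite ?inE // scale1r.
Qed.

Lemma loc_acyclicP (S : mulrClosed R) P :
  acyclic (loc_cplx S P) <-> torsion_homology (mem S) P.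
Proof.
split=> aP i x; last first.
  have [m [s ->]] := frac_surj x => fc.
  (* The numerator of a cycle in the localization is in general a cycle only after multiplication by
     some [t] in [S]. *)
  have [t cm] : exists t : denom S, is_cycle (dval t *: m).
    case: i m fc {x} => [|i] m /=; first by exists (denom1 S).
    rewrite loc_mapE -(frac0 _ (denom1 S)) => /fracP[t].
    by rewrite dval1 mulr1 scaler0 => e; exists t; rewrite linearZ.
  have [u uS [y yE]] := aP i _ cm.
  have uE : exists u' : denom S, dval u' = u by exists (exist _ u uS).
  case: uE => u' uE.
  exists (Defs.frac y (denomM (denomM u' t) s)) => /=; rewrite loc_mapE yE.
  by apply: frac_eq; rewrite !dvalM uE !scalerA -mulrA mulrC.
move=> cx; have [|y] := aP i (Defs.frac x (denom1 S)).
  by case: i x cx => //= i x cx; rewrite loc_mapE cx frac0.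
have [m [s ->]] := frac_surj y; rewrite /= loc_mapE => /fracP[t].
rewrite dval1 mulr1 => e; exists (dval t * dval s); first exact: (valP (denomM t s)).
by exists (dval t *: m); rewrite linearZ /= e.
Qed.

Section Koszul.
Variables (M : lmodType R) (s : R).

Definition koszul_obj i : lmodType R :=
  match i with 0 | 1 => M | _ => 'rV[R]_0 end.

Definition koszul_diff i : {linear koszul_obj i.+1 -> koszul_obj i} :=
  match i with
  | 0 => ( *:%R s : {linear M -> M})
  | _ => \0
  end.

Lemma koszul_diffK i x : koszul_diff i (koszul_diff i.+1 x) = 0.
Proof. by case: i x => [|i] x //=; rewrite scaler0. Qed.

Definition koszul := Cplx koszul_diffK.

Lemma koszul_torsion D : s \in D -> torsion_homology D koszul.
Proof.
move=> sD [|[|i]] x cx; exists s => //.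
- by exists x.
- by exists 0; rewrite raddf0; apply/esym.
- by exists 0; rewrite raddf0 [x]thinmx0 scaler0.
Qed.

Lemma koszul_fgproj : fgproj M -> forall i, fgproj (koszul i).
Proof. by move=> pM [|[|i]] //=; exact: fgproj0. Qed.

End Koszul.

(* If d h = s, this is the desuspension of the cone of the map
   koszul P_0 s -> P given by id and h, once P_0 has been cancelled. *)
Section Fold.
Variables (P : cplx R) (h : {linear P 0%N -> P 1%N}).

Definition fold_obj i : lmodType R :=
  match i with
  | 0 => P 1%N
  | 1 => (P 2%N * P 0%N)%type
  | j.+2 => P j.+3
  end.

Definition fold_diff i : {linear fold_obj i.+1 -> fold_obj i} :=
  match i with
  | 0 => (h \o snd) \- (cdiff P 1 \o fst)
  | 1 => lpair (\- cdiff P 2) \0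
  | j.+2 => \- cdiff P j.+3
  end.

Lemma fold_diffK i x : fold_diff i (fold_diff i.+1 x) = 0.
Proof.
case: i x => [|[|i]] x /=.
- by rewrite /= !raddf0 raddfN /= cdiffK oppr0 subr0.
- by rewrite /lpair_fun /= raddfN /= cdiffK !oppr0.
- by rewrite raddfN /= cdiffK !oppr0.
Qed.

Definition fold := Cplx fold_diffK.

Lemma fold_torsion D s : mulr_closed D -> s \in D ->
  (forall x, cdiff P 0 (h x) = s *: x) ->
  torsion_homology D P -> torsion_homology D fold.
Proof.
move=> [_ DM] sD hs tP [|[|i]] /= x.
(* In degree 0, [s *: x - h (d x)] is a cycle of [P]; adding back [t *: d x] in the summand [P 0]
   bounds [(t * s) *: x]. *)
- move=> _; have [|t tD [z zE]] := tP 1%N (s *: x - h (cdiff P 0 x)).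
    by rewrite /= raddfB /= hs linearZ subrr.
  exists (t * s); first exact: DM.
  exists (- z, t *: cdiff P 0 x) => /=.
  by rewrite [X in _ - X]raddfN /= opprK zE scalerBr scalerA linearZ /= addrC subrK.
- case: x => x b /= e.
  (* Applying [d] to [h b = d x] gives [s *: b = 0]; hence [s *: x] is a cycle of [P]. *)
  have sb : s *: b = 0.
    have := congr1 (cdiff P 0) e.
    by rewrite raddfB /= hs cdiffK subr0 raddf0.
  have [|t tD [z zE]] := tP 2%N (s *: x).
    move/subr0_eq: e => /= e; rewrite linearZ /= -e.
    by rewrite -linearZ sb raddf0.
  exists (t * s); first exact: DM.
  exists (- z) => /=; rewrite /lpair_fun /= raddfN /= opprK zE scalerA.
  by rewrite [RHS]surjective_pairing /= -[_ *: b]scalerA sb scaler0.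
- move=> e; have [|t tD [z zE]] := tP i.+3 x.
    by case: i x e => [|i] x /= => [[]|] /eqP; rewrite oppr_eq0 => /eqP.
  exists t => //; exists (- z) => /=.
  by rewrite raddfN /= opprK.
Qed.

Lemma fold_fgproj : (forall i, fgproj (P i)) -> forall i, fgproj (fold i).
Proof. by move=> pP [|[|i]] //=; exact: fgproj_prod. Qed.

End Fold.

Section Extension.
Variables (A B : cplx R) (th : forall i, {linear B i.+1 -> A i}).
Hypothesis thK : forall i x, cdiff A i (th i.+1 x) + th i (cdiff B i.+1 x) = 0.

(** The mapping cone of [th], seen as a chain map to [A] from [B] shifted down by one; the plus sign
    in [thK] reflects the negated differential of the shift. *)
Definition ext_obj i : lmodType R := (A i * B i)%type.

Definition ext_diff i : {linear ext_obj i.+1 -> ext_obj i} :=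
  lpair ((cdiff A i \o fst) \+ (th i \o snd)) (cdiff B i \o snd).

Lemma ext_diffK i x : ext_diff i (ext_diff i.+1 x) = 0.
Proof.
case: x => a b; apply/pair_equal_spec; split=> /=; last exact: cdiffK.
by rewrite raddfD /= cdiffK add0r thK.
Qed.

Definition ext := Cplx ext_diffK.

Lemma ext_torsion D : mulr_closed D ->
  torsion_homology D A -> torsion_homology D B -> torsion_homology D ext.
Proof.
move=> [_ DM] tA tB i [a b] ci.
have cb : is_cycle b by case: i a b ci => //= i a b [].
have [s sD [b' bE]] := tB _ _ cb.
(* Once [b'] bounds [s *: b], correcting [s *: a] by [th i b'] leaves a cycle of [A]. *)
have [|t tD [a' aE]] := tA i (s *: a - th i b').
  case: i a b {cb} ci b' bE => //= i a b [e e'] b' bE.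
  have /eqP := thK b'; rewrite bE linearZ /= addr_eq0 => /eqP thE.
  by rewrite raddfB /= linearZ /= thE opprK -scalerDr e scaler0.
exists (t * s); first exact: DM.
exists (a', t *: b'); apply/pair_equal_spec; split=> /=; last first.
  by rewrite linearZ /= bE scalerA.
by rewrite aE linearZ /= scalerBr subrK scalerA.
Qed.

Lemma ext_fgproj : (forall i, fgproj (A i)) -> (forall i, fgproj (B i)) ->
  forall i, fgproj (ext i).
Proof. by move=> pA pB i; exact: fgproj_prod. Qed.

Lemma ext_inlK i x : cdiff ext i (lpair idfun \0 x) = lpair idfun \0 (cdiff A i x).
Proof. by apply/pair_equal_spec; rewrite /= !raddf0 addr0. Qed.

Definition ext_inl : cmap A ext :=
  @CMap R A ext (fun i => lpair idfun \0) ext_inlK.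

Definition ext_snd : cmap ext B := @CMap R ext B (fun i => snd) (fun _ _ => erefl).

Lemma ext_exact : short_exact ext_inl ext_snd.
Proof.
move=> i; split; first by move=> x y [].
  by move=> z; exists (0, z).
by move=> [a b]; split=> [/= ->|[x [_ <-]]] //; exists a.
Qed.

End Extension.

End ComplexConstructions.

(** * Maps and short exact sequences between these complexes *)

Section ComplexMaps.
Variable R : comPzRingType.
Implicit Types (M N : lmodType R) (P Q : cplx R).

Section KoszulMap.
Variables (M N : lmodType R) (s : R) (f : {linear M -> N}).

Definition koszul_map_fun i : {linear koszul M s i -> koszul N s i} :=
  match i with 0 | 1 => f | _ => \0 end.

Lemma koszul_map_funK i x :
  cdiff (koszul N s) i (koszul_map_fun i.+1 x) =
  koszul_map_fun i (cdiff (koszul M s) i x).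
Proof. by case: i x => [|[|i]] x //=; rewrite ?linearZ ?raddf0. Qed.

Definition koszul_map := CMap koszul_map_funK.

End KoszulMap.

Lemma koszul_exact M' M M'' s (f : {linear M' -> M}) (g : {linear M -> M''}) :
  injective f -> (forall z, exists y, g y = z) ->
  (forall y, g y = 0 <-> exists x, f x = y) ->
  short_exact (koszul_map s f) (koszul_map s g).
Proof.
move=> fI gS fg [|[|i]]; split=> //=.
- by move=> x y _; rewrite [x]thinmx0 [y]thinmx0.
- by move=> z; exists 0; rewrite [z]thinmx0.
- by move=> y; split=> // _; exists 0; rewrite [y]thinmx0.
Qed.

Section FoldMap.
Variables (P Q : cplx R) (f : cmap P Q).
Variables (h : {linear P 0%N -> P 1%N}) (k : {linear Q 0%N -> Q 1%N}).
Hypothesis hk : forall x, f 1%N (h x) = k (f 0%N x).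

Definition fold_map_fun i : {linear fold h i -> fold k i} :=
  match i with
  | 0 => f 1%N
  | 1 => lpair (f 2%N \o fst) (f 0%N \o snd)
  | j.+2 => f j.+3
  end.

Lemma fold_map_funK i x :
  cdiff (fold k) i (fold_map_fun i.+1 x) = fold_map_fun i (cdiff (fold h) i x).
Proof.
case: i x => [|[|i]] x /=.
- by rewrite cmapd -hk raddfB.
- by rewrite /lpair_fun /= cmapd !raddf0 raddfN.
- by rewrite cmapd raddfN.
Qed.

Definition fold_map := CMap fold_map_funK.

End FoldMap.

Lemma fold_exact P' P P'' (f : cmap P' P) (g : cmap P P'')
    (h' : {linear P' 0%N -> P' 1%N}) (h : {linear P 0%N -> P 1%N})
    (h'' : {linear P'' 0%N -> P'' 1%N})
    (fh : forall x, f 1%N (h' x) = h (f 0%N x))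
    (gh : forall x, g 1%N (h x) = h'' (g 0%N x)) :
  short_exact f g -> short_exact (fold_map fh) (fold_map gh).
Proof.
move=> fg [|[|i]]; [exact: fg | | exact: fg].
have [fI0 gS0 fg0] := fg 0%N; have [fI2 gS2 fg2] := fg 2%N.
split=> /=.
- by move=> [x y] [x' y'] [/fI2 -> /fI0 ->].
- move=> [x y]; have [u <-] := gS2 x; have [v <-] := gS0 y.
  by exists (u, v).
- move=> [x y]; split=> [[/fg2[u <-] /fg0[v <-]]|[[u v] [<- <-]]].
    by exists (u, v).
  apply/pair_equal_spec; split; first by apply/fg2; exists u.
  by apply/fg0; exists v.
Qed.

Section FoldShear.
Variables (P : cplx R) (h : {linear P 0%N -> P 1%N}).
Variables (h' : {linear P 0%N -> P 1%N}) (k : {linear P 0%N -> P 2%N}).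
Hypothesis hh' : forall x, cdiff P 1 (k x) = h x - h' x.

Definition fold_shear_fun i : {linear fold h i -> fold h' i} :=
  match i with
  | 1 => lpair (fst \- (k \o snd)) snd
  | 0 | _ => idfun
  end.

Lemma fold_shear_funK i x :
  cdiff (fold h') i (fold_shear_fun i.+1 x) = fold_shear_fun i (cdiff (fold h) i x).
Proof.
case: i x => [|[|i]] x //=.
  by rewrite [X in _ - X]raddfB /= hh' opprB addrCA addrA subrK addrC.
by rewrite /lpair_fun /= raddf0 subr0.
Qed.

Definition fold_shear := CMap fold_shear_funK.

End FoldShear.

(** The shear [(x, b) |-> (x - k b, b)] in degree 1 absorbs the change of [h], and the shear by
    [- k] undoes it. *)
Lemma fold_homotopic P (h h' : {linear P 0%N -> P 1%N}) (k : {linear P 0%N -> P 2%N}) :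
  (forall x, cdiff P 1 (k x) = h x - h' x) -> ciso (fold h) (fold h').
Proof.
move=> hh'.
have h'h x : cdiff P 1 ((\- k) x) = h' x - h x by rewrite /= raddfN /= hh' opprB.
exists (fold_shear hh'), (fold_shear h'h).
by move=> [|[|i]]; split=> // -[x y]; rewrite /= /lpair_fun /= ?opprK ?subrK ?addrK.
Qed.

Section FoldScale.
Variables (P : cplx R) (h : {linear P 0%N -> P 1%N}) (t : R).

(** Gluing the summand [P 0] of [fold h] to the Koszul complex of [t] gives an extension that maps
    onto [fold (t \*: h)] with kernel the contractible Koszul complex of 1. *)
Definition fold_scale_twist i : {linear fold h i.+1 -> koszul (P 0%N) t i} :=
  match i with 0 => snd | _ => \0 end.

Lemma fold_scale_twistK i x :
  cdiff (koszul (P 0%N) t) i (fold_scale_twist i.+1 x) +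
  fold_scale_twist i (cdiff (fold h) i.+1 x) = 0.
Proof. by case: i x => [|i] x /=; rewrite ?scaler0 addr0. Qed.

Definition fold_scale_ext := ext fold_scale_twistK.

Definition fold_scale_in_fun i : {linear koszul (P 0%N) 1 i -> fold_scale_ext i} :=
  match i with
  | 0 => lpair idfun h
  | 1 => lpair \0 (lpair \0 idfun)
  | _ => \0
  end.

Lemma fold_scale_in_funK i x :
  cdiff fold_scale_ext i (fold_scale_in_fun i.+1 x) =
  fold_scale_in_fun i (cdiff (koszul (P 0%N) 1) i x).
Proof.
case: i x => [|[|i]] x; try by rewrite !raddf0.
by rewrite /= /lpair_fun /= scale1r scaler0 add0r raddf0 subr0.
Qed.

Definition fold_scale_in := CMap fold_scale_in_funK.

Definition fold_scale_out_fun i : {linear fold_scale_ext i -> fold (t \*: h) i} :=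
  match i with
  | 0 => snd \- (h \o fst)
  | 1 => lpair (fst \o snd) (\- fst)
  | _ => snd
  end.

Lemma fold_scale_out_funK i x :
  cdiff (fold (t \*: h)) i (fold_scale_out_fun i.+1 x) =
  fold_scale_out_fun i (cdiff fold_scale_ext i x).
Proof.
case: i x => [|[|i]] [a x] //=; last by rewrite /lpair_fun /= addr0 oppr0.
case: x => x b /=.
rewrite raddfD /= linearZ /= raddfN scalerN opprD.
by rewrite [in RHS]addrC addrA subrK.
Qed.

Definition fold_scale_out := CMap fold_scale_out_funK.

Lemma fold_scale_exact : short_exact fold_scale_in fold_scale_out.
Proof.
move=> [|[|i]]; split.
- by move=> x y [].
- by move=> z; exists (0, z); rewrite /= raddf0 subr0.
- move=> [u y] /=; split=> [/subr0_eq /= ->|[x [<- <-]]]; last exact: subrr.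
  by exists u.
- by move=> x y [].
- by move=> [x b]; exists (- b, (x, 0)); rewrite /= /lpair_fun /= opprK.
- move=> [a [x b]] /=; split=> [[-> /eqP]|[y [<- <- _]]].
    by rewrite oppr_eq0 => /eqP ->; exists b.
  by rewrite /lpair_fun /= oppr0.
- by move=> x y _; rewrite [x]thinmx0 [y]thinmx0.
- by move=> z; exists (0, z).
- move=> [z y]; split=> /= [->|[x [_ <-]]] //.
  by exists 0; rewrite [z]thinmx0.
Qed.

End FoldScale.

Section Tail.
Variable P : cplx R.

Definition tail_obj i : lmodType R :=
  match i with 0 => P 1%N | j.+1 => (P j.+2 * P j.+1)%type end.

Definition tail_diff i : {linear tail_obj i.+1 -> tail_obj i} :=
  match i with
  | 0 => snd \- (cdiff P 1 \o fst)
  | j.+1 => lpair (snd \- (cdiff P j.+2 \o fst)) (cdiff P j.+1 \o snd)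
  end.

Lemma tail_diffK i x : tail_diff i (tail_diff i.+1 x) = 0.
Proof.
by case: i x => [|i] x; rewrite /= /lpair_fun /= raddfB /= !cdiffK subr0 subrr.
Qed.

(* The mapping cone of the identity of the part of P in positive degrees. *)
Definition tail_cone := Cplx tail_diffK.

Lemma tail_cone_acyclic : acyclic tail_cone.
Proof.
move=> [|i]; first by move=> x _; exists (0, x); rewrite /= raddf0 subr0.
move=> [x y] /= e; exists (0, x); rewrite /= /lpair_fun /= raddf0 subr0.
by congr pair; case: i x y e => [|i] x y /= => [|[]] /subr0_eq.
Qed.

Lemma tail_cone_fgproj : (forall i, fgproj (P i)) -> forall i, fgproj (tail_cone i).
Proof. by move=> pP [|i] //=; exact: fgproj_prod. Qed.

Variables (h : {linear P 0%N -> P 1%N}) (s : R).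
Hypothesis hs : forall x, cdiff P 0 (h x) = s *: x.

(** This glues [P] in positive degrees to its copy in [fold h]. The glued copies form [tail_cone P];
    a [P 0] in degrees 1 and 0 remains, which is the Koszul complex of [s]. *)
Definition fold_twist i : {linear P i.+1 -> fold h i} :=
  match i with
  | 0 => idfun
  | 1 => lpair idfun \0
  | _ => idfun
  end.

Lemma fold_twistK i x :
  cdiff (fold h) i (fold_twist i.+1 x) + fold_twist i (cdiff P i.+1 x) = 0.
Proof.
case: i x => [|[|i]] x /=; rewrite ?addNr //.
  by rewrite raddf0 add0r addNr.
by apply/pair_equal_spec; rewrite /= addNr addr0.
Qed.

Definition fold_ext := ext fold_twistK.

Definition fold_ext_in_fun i : {linear tail_cone i -> fold_ext i} :=
  match i with
  (* The component [cdiff P 0] restores the differential from [P 1] to [P 0], which the truncation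
     forgets. *)
  | 0 => lpair idfun (cdiff P 0)
  | 1 => lpair (lpair fst \0) snd
  | _ => idfun
  end.

Lemma fold_ext_in_funK i x :
  cdiff fold_ext i (fold_ext_in_fun i.+1 x) = fold_ext_in_fun i (cdiff tail_cone i x).
Proof.
case: i x => [|[|i]] [x y]; rewrite /= /lpair_fun /=.
- by rewrite raddf0 add0r raddfB /= cdiffK subr0 addrC.
- congr pair; apply/pair_equal_spec; rewrite /= addr0; split=> //.
  by rewrite addrC.
- by rewrite addrC.
Qed.

Definition fold_ext_in := CMap fold_ext_in_funK.

Definition fold_ext_out_fun i : {linear fold_ext i -> koszul (P 0%N) s i} :=
  match i with
  | 0 => snd \- (cdiff P 0 \o fst)
  | 1 => \- (snd \o fst)
  | _ => \0
  end.

Lemma fold_ext_out_funK i x :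
  cdiff (koszul (P 0%N) s) i (fold_ext_out_fun i.+1 x) =
  fold_ext_out_fun i (cdiff fold_ext i x).
Proof.
case: i x => [|[|i]] [x y] //=; last by rewrite addr0 oppr0.
rewrite raddfD raddfB /= hs cdiffK subr0.
by rewrite opprD addrCA subrr addr0 scalerN.
Qed.

Definition fold_ext_out := CMap fold_ext_out_funK.

Lemma fold_ext_exact : short_exact fold_ext_in fold_ext_out.
Proof.
move=> [|[|i]]; split.
- by move=> x y [].
- by move=> z; exists (0, z); rewrite /= raddf0 subr0.
- move=> [y p] /=; split=> [/subr0_eq /= ->|[x [<- <-]]]; last exact: subrr.
  by exists y.
- by move=> [x y] [x' y'] [-> ->].
- by move=> z; exists ((0, - z), 0); rewrite /= opprK.
- move=> [[x b] y] /=; split=> [/eqP|[[u v] [_ <- _]]]; last exact: oppr0.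
  by rewrite oppr_eq0 => /eqP ->; exists (x, y).
- by [].
- by move=> z; exists 0; rewrite [z]thinmx0.
- by move=> y; split=> // _; exists y.
Qed.

End Tail.

End ComplexMaps.

(** * Identities and homomorphisms of abelian groups *)

Section AbelianGroups.

Lemma agBD2l (G : abGroup) (a b c : G) :
  agD (agD a b) (agN (agD a c)) = agD b (agN c).
Proof. by rewrite agND2 agDACA agDN ag0D. Qed.

Lemma agBDACA (G : abGroup) (a b c d : G) :
  agD (agD a b) (agN (agD c d)) = agD (agD a (agN c)) (agD b (agN d)).
Proof. by rewrite agND2 agDACA. Qed.

Lemma agB_congr (G : abGroup) (a b c d : G) :
  a = b -> c = d -> agD a (agN c) = agD b (agN d).
Proof. by move=> -> ->. Qed.

Lemma agDBK (G : abGroup) (a b : G) : agD (agD a b) (agN a) = b.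
Proof. by rewrite agDC agDA agND ag0D. Qed.

Definition ah_comp (G H K : abGroup) (g : abHom H K) (f : abHom G H) : abHom G K :=
  @AbHom G K (g \o f) (fun x y => etrans (congr1 g (ah_D f x y)) (ah_D g _ _)).

Lemma ah_compE (G H K : abGroup) (g : abHom H K) (f : abHom G H) x :
  ah_comp g f x = g (f x).
Proof. by []. Qed.

Definition ah_id (G : abGroup) : abHom G G := @AbHom G G id (fun _ _ => erefl).

Lemma abIso_comp (G H K : abGroup) (g : abHom H K) (f : abHom G H) :
  abIso f -> abIso g -> abIso (ah_comp g f).
Proof.
move=> [f' [fK f'K]] [g' [gK g'K]]; exists (ah_comp f' g').
by split=> x /=; rewrite ?gK ?fK ?f'K ?g'K.
Qed.

Lemma abIso_eq (G H : abGroup) (f g : abHom G H) : f =1 g -> abIso f -> abIso g.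
Proof.
by move=> fg [f' [fK f'K]]; exists f'; split=> x; rewrite -fg ?fK ?f'K.
Qed.

End AbelianGroups.

(** * Classes of Koszul complexes, folds and extensions in the K-groups *)

Section Kclasses.
Variables (R : comPzRingType) (S : mulrClosed R).
Implicit Types (n m : natinf) (A B P Q : cplx R).

Local Notation K n H := (Kclass (@MkKcplx R S n _ H)).

Let S_closed : mulr_closed (mem S).
Proof. by split=> [|x y]; [exact: rpred1 | exact: rpredM]. Qed.

Lemma Kgroup_ext n (G : abGroup) (f g : abHom (Kgroup S n) G) :
  (forall P : Kcplx S n, f (Kclass P) = g (Kclass P)) -> f =1 g.
Proof.
move=> fg x; have [a ->] := qproj_surj x; elim/freeAb_ind: a => [c||a IH|a b IHa IHb].
- by have [P ->] := cls_surj c; exact: fg.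
- by rewrite !ah_0.
- by rewrite !ah_N IH.
- by rewrite !ah_D IHa IHb.
Qed.

Lemma Kclass_irr n P (H H' : Kcplx_spec S n P) : K n H = K n H'.
Proof. by rewrite (Prop_irrelevance H H'). Qed.

Lemma Kclass_iso n P Q (HP : Kcplx_spec S n P) (HQ : Kcplx_spec S n Q) :
  ciso P Q -> K n HP = K n HQ.
Proof. by move=> PQ; congr (qproj _ (fgen _)); apply/(clsP (Kciso_equiv S n)). Qed.

Lemma Kclass_exact n P' P P'' (H' : Kcplx_spec S n P') (H : Kcplx_spec S n P)
    (H'' : Kcplx_spec S n P'') (f : cmap P' P) (g : cmap P P'') :
  short_exact f g -> K n H = agD (K n H') (K n H'').
Proof.
move=> fg; apply: agB_eq0; rewrite /Kclass -[X in agD _ (agN X)]ah_D -ah_N -ah_D; apply: qproj_rel.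
exact: (@Krel_exact _ _ n (MkKcplx H') (MkKcplx H) (MkKcplx H'') f g fg).
Qed.

Lemma Kclass_acyclic n P (H : Kcplx_spec S n P) : acyclic P -> K n H = ag0.
Proof. by move=> aP; apply: qproj_rel; exact: (@Krel_acyclic _ _ n (MkKcplx H)). Qed.

Lemma Kcplx_fgproj n P : Kcplx_spec S n P -> forall i, fgproj (P i).
Proof. by case=> _ _ fP pP _ i; split. Qed.

Lemma Kcplx_torsion n P : Kcplx_spec S n P -> torsion_homology (mem S) P.
Proof. by move=> /Kloc_exact /loc_acyclicP. Qed.

Lemma Kcplx_specI n P : (exists N, forall i, (N < i)%N -> zero_module (P i)) ->
  (forall i : nat, ~~ lei i n -> zero_module (P i)) -> (forall i, fgproj (P i)) ->
  torsion_homology (mem S) P -> Kcplx_spec S n P.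
Proof.
by move=> bP rP pP tP; split=> // [i|i|]; [case: (pP i) | case: (pP i) | apply/loc_acyclicP].
Qed.

Lemma acyclic_torsion P : acyclic P -> torsion_homology (mem S) P.
Proof. by move=> aP i x /aP bx; exists 1; rewrite ?scale1r //; exact: rpred1. Qed.

Lemma koszul_spec n (M : lmodType R) s :
  lei 1%N n -> fgproj M -> s \in S -> Kcplx_spec S n (koszul M s).
Proof.
move=> n1 pM sS; apply: Kcplx_specI.
- by exists 1%N => -[|[|i]] // _ x; rewrite [x]thinmx0.
- move=> [|[|i]]; last by move=> _ x; rewrite [x]thinmx0.
    by rewrite (@lei_trans 0%N 1%N).
  by rewrite n1.
- exact: koszul_fgproj.
- exact: koszul_torsion.
Qed.

Lemma koszul1_class n (M : lmodType R) (H : Kcplx_spec S n (koszul M 1)) :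
  K n H = ag0.
Proof.
by apply: Kclass_acyclic; apply/acyclicP; apply: koszul_torsion; rewrite inE.
Qed.

Lemma ext_spec n A B (th : forall i, {linear B i.+1 -> A i})
    (thK : forall i x, cdiff A i (th i.+1 x) + th i (cdiff B i.+1 x) = 0) :
  Kcplx_spec S n A -> Kcplx_spec S n B -> Kcplx_spec S n (ext thK).
Proof.
move=> HA HB; have [[N bA] rA _ _ _] := HA; have [[N' bB] rB _ _ _] := HB.
apply: Kcplx_specI.
- exists (maxn N N') => i; rewrite gtn_max => /andP[Ni N'i] [x y].
  by rewrite [x]bA // [y]bB.
- by move=> i ni [x y]; rewrite [x]rA // [y]rB.
- exact: ext_fgproj (Kcplx_fgproj HA) (Kcplx_fgproj HB).
- exact: ext_torsion (Kcplx_torsion HA) (Kcplx_torsion HB).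
Qed.

Lemma ext_class n A B (th : forall i, {linear B i.+1 -> A i})
    (thK : forall i x, cdiff A i (th i.+1 x) + th i (cdiff B i.+1 x) = 0)
    (HA : Kcplx_spec S n A) (HB : Kcplx_spec S n B) (H : Kcplx_spec S n (ext thK)) :
  K n H = agD (K n HA) (K n HB).
Proof. exact: Kclass_exact (ext_exact thK). Qed.

(** The second condition says that [n] is at most [m + 1]. It covers [m = n], by [lei_pred], as well
    as a range shortened by one degree. *)
Lemma fold_spec m n P (h : {linear P 0%N -> P 1%N}) s : lei 1%N m ->
  (forall i : nat, lei i.+1 n -> lei i m) -> Kcplx_spec S n P -> s \in S ->
  (forall x, cdiff P 0 (h x) = s *: x) -> Kcplx_spec S m (fold h).
Proof.
move=> m1 nm HP sS hs; have [[N bP] rP _ _ _] := HP.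
apply: Kcplx_specI.
(* The bound has to be at least 1, because [P 0] sits in degree 1 of the fold. *)
- exists N.+1 => -[|[|i]] // Ni; apply: (bP i.+3); exact: ltnW (ltnW Ni).
- move=> [|[|i]] im; [| |by apply: (rP i.+3); apply: contra im; exact: nm].
    by rewrite (@lei_trans 0%N 1%N) in im.
  by rewrite m1 in im.
- exact: fold_fgproj (Kcplx_fgproj HP).
- exact: fold_torsion hs (Kcplx_torsion HP).
Qed.

Lemma lei_pred n i : lei (Fin i.+1) n -> lei (Fin i) n.
Proof. by apply: lei_trans => /=. Qed.

Lemma tail_cone_spec n P : lei 1%N n -> Kcplx_spec S n P ->
  Kcplx_spec S n (tail_cone P).
Proof.
move=> n1 HP; have [[N bP] rP _ _ _] := HP; apply: Kcplx_specI.
- exists N.+1 => -[|i] // Ni [x y].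
  by rewrite [x]bP ?[y]bP //; [exact: ltnW | exact: leqW (ltnW Ni)].
- move=> [|i] ni; first by rewrite (@lei_trans 0%N 1%N) in ni.
  move=> [x y]; rewrite [y]rP // [x]rP //.
  by apply: contra ni; exact: lei_pred.
- exact: tail_cone_fgproj (Kcplx_fgproj HP).
- exact/acyclic_torsion/tail_cone_acyclic.
Qed.

Lemma fold_scale_class n P (h : {linear P 0%N -> P 1%N}) t
    (Hh : Kcplx_spec S n (fold h)) (Ht : Kcplx_spec S n (koszul (P 0%N) t))
    (H : Kcplx_spec S n (fold (t \*: h))) :
  lei 1%N n -> K n H = agD (K n Ht) (K n Hh).
Proof.
move=> n1; have p0 : fgproj (P 0%N) := Kcplx_fgproj Ht 0.
have H1 := koszul_spec n1 p0 (rpred1 S).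
have HE := ext_spec (@fold_scale_twistK _ _ h t) Ht Hh.
rewrite -(ext_class Ht Hh HE) (Kclass_exact H1 HE H (fold_scale_exact h t)).
by rewrite koszul1_class ag0D.
Qed.

(** The class of [fold_ext] is computed twice: from [fold h] and [P], and from the acyclic
    [tail_cone P] and the Koszul complex. *)
Lemma koszul_fold_class n P (h : {linear P 0%N -> P 1%N}) s
    (HP : Kcplx_spec S n P) (Hh : Kcplx_spec S n (fold h))
    (Hs : Kcplx_spec S n (koszul (P 0%N) s)) :
  lei 1%N n -> (forall x, cdiff P 0 (h x) = s *: x) ->
  K n Hs = agD (K n Hh) (K n HP).
Proof.
move=> n1 hs; have HE := ext_spec (fold_twistK h) Hh HP.
have HT := tail_cone_spec n1 HP.
rewrite -(ext_class Hh HP HE) (Kclass_exact HT HE Hs (fold_ext_exact hs)).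
by rewrite (Kclass_acyclic HT) ?ag0D //; exact: tail_cone_acyclic.
Qed.

Lemma koszul_mul_class n (M : lmodType R) s t (Hs : Kcplx_spec S n (koszul M s))
    (Ht : Kcplx_spec S n (koszul M t)) (H : Kcplx_spec S n (koszul M (t * s))) :
  lei 1%N n -> s \in S -> t \in S -> K n H = agD (K n Ht) (K n Hs).
Proof.
move=> n1 sS tS; have pM : fgproj M := Kcplx_fgproj Hs 0.
(* Both sides are classes of folds of the acyclic complex koszul M 1. *)
pose P := koszul M 1; pose h : {linear P 0%N -> P 1%N} := ( *:%R s : {linear M -> M}).
have H1 : Kcplx_spec S n P := koszul_spec n1 pM (rpred1 S).
have hs x : cdiff P 0 (h x) = s *: x by rewrite /= scale1r.
have hts x : cdiff P 0 ((t \*: h) x) = (t * s) *: x by rewrite /= scale1r scalerA.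
have Hh := fold_spec n1 (@lei_pred n) H1 sS hs.
have Hth := fold_spec n1 (@lei_pred n) H1 (rpredM tS sS) hts.
rewrite (koszul_fold_class H1 Hth H n1 hts) (koszul_fold_class H1 Hh Hs n1 hs).
by rewrite koszul1_class !agD0 (fold_scale_class Hh Ht Hth).
Qed.

(** A contracting homotopy in degree 0 only, up to a denominator. *)
Record contraction P := Contraction {
  ct_den : R;
  ct_map : {linear P 0%N -> P 1%N};
  ct_denP : ct_den \in S;
  ct_mapP : forall x, cdiff P 0 (ct_map x) = ct_den *: x }.

Lemma contraction_exists n P : Kcplx_spec S n P -> inhabited (contraction P).
Proof.
move=> HP; have [|s sS [h hs]] :=
    fgproj_factor_denom (g := cdiff P 0) (f := idfun) S_closed (Kcplx_fgproj HP 0).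
  move=> x; have [//|s sS [y yE]] := Kcplx_torsion HP (i := 0) (x := x).
  by exists s => //; exists y.
by constructor; exact: (@Contraction P s h).
Qed.

(** * The inverse on complexes: independence of choices and the defining relations *)

Section FoldClass.
Variables (m n : natinf).
Hypotheses (m1 : lei 1%N m) (nm : forall i : nat, lei i.+1 n -> lei i m).

Definition fold_class P (HP : Kcplx_spec S n P) (c : contraction P) : Kgroup S m :=
  agD (K m (koszul_spec m1 (Kcplx_fgproj HP 0) (ct_denP c)))
      (agN (K m (fold_spec m1 nm HP (ct_denP c) (ct_mapP c)))).

Lemma scale_contraction_subproof P (c : contraction P) t x :
  cdiff P 0 ((t \*: ct_map c) x) = (t * ct_den c) *: x.
Proof. by rewrite /= linearZ /= ct_mapP scalerA. Qed.

Definition scale_contraction P (c : contraction P) t (tS : t \in S) :=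
  Contraction (rpredM tS (ct_denP c)) (scale_contraction_subproof c t).

Lemma fold_class_scale P (HP : Kcplx_spec S n P) (c : contraction P) t (tS : t \in S) :
  fold_class HP (scale_contraction c tS) = fold_class HP c.
Proof.
have Ht := koszul_spec m1 (Kcplx_fgproj HP 0) tS.
rewrite /fold_class.
rewrite (koszul_mul_class (koszul_spec m1 (Kcplx_fgproj HP 0) (ct_denP c)) Ht) ?ct_denP //.
rewrite (fold_scale_class (fold_spec m1 nm HP (ct_denP c) (ct_mapP c)) Ht) //.
exact: agBD2l.
Qed.

Lemma fold_class_uniq P (HP HP' : Kcplx_spec S n P) (c c' : contraction P) :
  fold_class HP c = fold_class HP' c'.
Proof.
rewrite (Prop_irrelevance HP' HP) {HP'}.
(* Equal denominators suffice: scaling each contraction by the denominator of the other makes them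
   equal and preserves both values. *)
have same_den (b b' : contraction P) : ct_den b = ct_den b' ->
    fold_class HP b = fold_class HP b'.
  case: b b' => [s h sS hs] [s' h' s'S hs'] /= ss'.
  move: ss' s'S hs' => <- s'S hs'.
  (* As [h - h'] takes values in cycles and the first homology is [S]-torsion, some multiple of it
     lifts through [P 2]. *)
  have [|t tS [k kE]] := fgproj_factor_denom (g := cdiff P 1) (f := h \- h')
      S_closed (Kcplx_fgproj HP 0).
    move=> x; have [|t tS [y yE]] := Kcplx_torsion HP (i := 1) (x := (h \- h') x).
      by rewrite /= raddfB /= hs hs' subrr.
    by exists t => //; exists y.
  rewrite -(fold_class_scale HP (Contraction sS hs) tS).
  rewrite -(fold_class_scale HP (Contraction s'S hs') tS).
  rewrite /fold_class; apply: (@agB_congr (Kgroup S m)); first exact: Kclass_irr.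
  by apply/Kclass_iso/(fold_homotopic (k := k)) => x; rewrite kE /= scalerBr.
rewrite -(fold_class_scale HP c (ct_denP c')) -(fold_class_scale HP c' (ct_denP c)).
by apply: same_den; rewrite /= mulrC.
Qed.

(** Denominator 1 is available here. Then both terms vanish, the fold being acyclic by
    [fold_torsion] for the singleton of 1. *)
Lemma fold_class_acyclic P (HP : Kcplx_spec S n P) (c : contraction P) :
  acyclic P -> fold_class HP c = ag0.
Proof.
move=> aP; have [|h hP] := fgproj_factor (g := cdiff P 0) (f := idfun) (Kcplx_fgproj HP 0).
  by move=> x; exact: aP.
have h1 x : cdiff P 0 (h x) = 1 *: x by rewrite hP scale1r.
rewrite (fold_class_uniq HP HP c (Contraction (rpred1 S) h1)) /fold_class.
rewrite koszul1_class Kclass_acyclic ?agN0 ?ag0D //.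
apply/acyclicP/(fold_torsion _ _ h1); rewrite ?inE //; last exact/acyclicP.
by split=> [|x y]; rewrite ?inE // => /eqP -> /eqP ->; rewrite mulr1.
Qed.

Lemma fold_class_exact P' P P'' (H' : Kcplx_spec S n P') (H : Kcplx_spec S n P)
    (H'' : Kcplx_spec S n P'') (c' : contraction P') (c : contraction P)
    (c'' : contraction P'') (f : cmap P' P) (g : cmap P P'') :
  short_exact f g ->
  fold_class H c = agD (fold_class H' c') (fold_class H'' c'').
Proof.
move=> fg; have [f0I g0S fg0] := fg 0%N; have [f1I g1S fg1] := fg 1%N.
(* Cross-multiplication gives the two ends a common denominator [s]. *)
wlog cc' : c' c'' / ct_den c' = ct_den c''.
  move=> /(_ (scale_contraction c' (ct_denP c'')) (scale_contraction c'' (ct_denP c'))).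
  by rewrite !fold_class_scale; apply; rewrite /= mulrC.
case: c' c'' cc' => [s h' sS h's] [s' h'' s'S h''s] ss'.
rewrite /= in ss'; move: ss' s'S h''s => <- s'S h''s.
have pP'' := Kcplx_fgproj H'' 0.
(* [sg] splits [g] in degree 0, with retraction [r] onto [P' 0]; [u] lifts [h''], and [w] is the
   error in [d u = s *: sg], pulled back to [P' 0]. *)
have [|sg sgE] := fgproj_factor (g := g 0%N) (f := idfun) pP''; first exact: g0S.
have [|u uE] := fgproj_factor (g := g 1%N) (f := h'') pP''.
  by move=> x; exact: g1S.
have [|w wE] := fgproj_factor (g := f 0%N)
    (f := (cdiff P 0 \o u) \- (s \*: sg)) pP''.
  move=> x; apply/fg0; rewrite /= raddfB /= -cmapd /= uE h''s linearZ /= sgE.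
  exact: subrr.
have [|r rE] := fgproj_factor (g := f 0%N) (f := idfun \- (sg \o g 0%N))
    (Kcplx_fgproj H 0).
  by move=> x; apply/fg0; rewrite /= raddfB /= sgE subrr.
(* Since [d (h' w) = s *: w], the error can be removed from [s \*: u] but not from [u] itself; this
   is the source of the denominator [s * s]. *)
pose v : {linear P'' 0%N -> P 1%N} := (s \*: u) \- (f 1%N \o h' \o w).
(* Along [x = f (r x) + sg (g x)], the map is [s \*: h'] on the first summand and [v] on the
   second. *)
pose h : {linear P 0%N -> P 1%N} := (s \*: (f 1%N \o h' \o r)) \+ (v \o g 0%N).
have vs x : cdiff P 0 (v x) = (s * s) *: sg x.
  rewrite /v /= raddfB /= linearZ /= cmapd h's linearZ /= wE /=.
  by rewrite -scalerBr opprB addrCA subrr addr0 scalerA.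
have hs x : cdiff P 0 (h x) = (s * s) *: x.
  rewrite /h /= raddfD /= vs linearZ /= cmapd h's linearZ /= rE /= scalerA.
  by rewrite -scalerDr subrK.
have gf0 x : g 0%N (f 0%N x) = 0 by apply/fg0; exists x.
have r0 x : r (f 0%N x) = x.
  by apply: f0I; rewrite rE /= gf0 raddf0 subr0.
have fh x : f 1%N ((s \*: h') x) = h (f 0%N x).
  have -> : h (f 0%N x) = s *: f 1%N (h' (r (f 0%N x))) + v (g 0%N (f 0%N x)) by [].
  by rewrite r0 gf0 (raddf0 v) addr0 /= linearZ.
have gh x : g 1%N (h x) = (s \*: h'') (g 0%N x).
  have gf y : g 1%N (f 1%N y) = 0 by apply/fg1; exists y.
  by rewrite /h /v /= raddfD /= raddfB /= !linearZ /= !gf scaler0 subr0 add0r uE.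
rewrite -(fold_class_scale H' (Contraction sS h's) sS).
rewrite -(fold_class_scale H'' (Contraction s'S h''s) sS).
rewrite (fold_class_uniq H H c (Contraction (rpredM sS sS) hs)).
rewrite /fold_class -agBDACA; apply: (@agB_congr (Kgroup S m)).
  exact: Kclass_exact (koszul_exact (s * s) f0I g0S fg0).
exact: Kclass_exact (fold_exact fh gh fg).
Qed.

End FoldClass.

(** * The universal property of the K-groups *)

Section Lift.
Variables (n : natinf) (G : abGroup) (F : Kcplx S n -> G).
Hypothesis Fexact : forall (P' P P'' : Kcplx S n) (f : cmap P' P) (g : cmap P P''),
  short_exact f g -> F P = agD (F P') (F P'').
Hypothesis Facyclic : forall P : Kcplx S n, acyclic P -> F P = ag0.

Definition zero_cplx : cplx R :=
  @Cplx R (fun=> 'rV[R]_0) (fun=> \0) (fun _ _ => erefl).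

Lemma zero_cplx_acyclic : acyclic zero_cplx.
Proof. by move=> i x _; exists 0; rewrite [x]thinmx0. Qed.

Lemma zero_cplx_spec : Kcplx_spec S n zero_cplx.
Proof.
apply: Kcplx_specI => [|i _ x|i|]; try by rewrite [x]thinmx0.
- by exists 0 => i _ x; rewrite [x]thinmx0.
- exact: fgproj0.
- exact/acyclic_torsion/zero_cplx_acyclic.
Qed.

(** An isomorphism is part of a short exact sequence whose kernel is the acyclic zero complex, so
    the two relations already force invariance. *)
Lemma lift_iso (P Q : Kcplx S n) : Kciso P Q -> F P = F Q.
Proof.
move=> [f [g fg]].
pose z : cmap zero_cplx P :=
  @CMap R zero_cplx P (fun=> \0) (fun i _ => raddf0 (cdiff P i)).
rewrite (Fexact (P' := MkKcplx zero_cplx_spec) (f := z) (g := f)).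
  by rewrite (Facyclic (P := MkKcplx zero_cplx_spec) zero_cplx_acyclic) ag0D.
move=> i; have [fK gK] := fg i; split.
- by move=> x y _; rewrite [x]thinmx0 [y]thinmx0.
- by move=> y; exists (g i y).
- move=> x; split=> [|[y <-]]; last exact: raddf0.
  by rewrite -(raddf0 (f i)) => /(can_inj fK) ->; exists 0.
Qed.

Let Ffree : abHom (Kfree S n) G := freeAb_lift (quo_lift F).

Let FfreeE (P : Kcplx S n) : Ffree (fclass P) = F P.
Proof. by rewrite freeAb_liftE quo_liftE //; [exact: Kciso_equiv | exact: lift_iso]. Qed.

Lemma Ffree_rel x : Krel x -> Ffree x = ag0.
Proof.
case=> [P' P P'' f g /Fexact fg|P /Facyclic aP]; last by rewrite FfreeE.
by rewrite !(ah_D, ah_N) !FfreeE fg agDN.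
Qed.

Definition Kgroup_lift : abHom (Kgroup S n) G := quotAb_lift Ffree_rel.

Lemma Kgroup_liftE (P : Kcplx S n) : Kgroup_lift (Kclass P) = F P.
Proof. by rewrite -FfreeE; apply: quotAb_liftE; exact: Ffree_rel. Qed.

End Lift.

(** * Ranges that differ by at most one degree *)

Section Step.
Variables (m n : natinf).
Hypotheses (m1 : lei 1%N m) (nm : forall i : nat, lei i.+1 n -> lei i m).
Hypothesis mn : lei m n.

(** An arbitrary choice for each complex is harmless: [fold_class_exact] holds for any three
    contractions. *)
Definition some_contraction (P : Kcplx S n) : contraction P :=
  sval (cid (let: inhabits c := contraction_exists (KcplxP P) in
             ex_intro (fun=> True) c I)).

Definition Kgroup_fold : abHom (Kgroup S n) (Kgroup S m) :=
  @Kgroup_lift n _ (fun P : Kcplx S n => fold_class m1 nm (KcplxP P) (some_contraction P))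
    (fun (P' P P'' : Kcplx S n) f g fg => fold_class_exact m1 nm (KcplxP P') (KcplxP P) (KcplxP P'')
       (some_contraction P') (some_contraction P) (some_contraction P'') fg)
    (fun (P : Kcplx S n) aP => fold_class_acyclic m1 nm (KcplxP P) (some_contraction P) aP).

(** By [koszul_fold_class], read in range [m] for one composite and in range [n] for the other, the
    Koszul class minus the fold class is the class of [P]. *)
Lemma Kmap_step : abIso (Kmap S mn).
Proof.
have n1 : lei 1%N n := lei_trans m1 mn.
exists Kgroup_fold; split.
  apply: (@Kgroup_ext m _ (ah_comp Kgroup_fold (Kmap S mn)) (ah_id _)) => P.
  rewrite ah_compE KmapE Kgroup_liftE /fold_class; set c := some_contraction _.
  have Hh := fold_spec m1 (@lei_pred m) (KcplxP P) (ct_denP c) (ct_mapP c).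
  rewrite (Kclass_irr _ Hh) (koszul_fold_class (KcplxP P) Hh _ m1 (ct_mapP c)).
  by rewrite agDBK; case: P {c Hh} => P HP; exact: Kclass_irr.
apply: (@Kgroup_ext n _ (ah_comp (Kmap S mn) Kgroup_fold) (ah_id _)) => P.
rewrite ah_compE Kgroup_liftE /fold_class ah_D ah_N !KmapE; set c := some_contraction _.
have Hh := fold_spec n1 (@lei_pred n) (KcplxP P) (ct_denP c) (ct_mapP c).
have Hs := koszul_spec n1 (Kcplx_fgproj (KcplxP P) 0) (ct_denP c).
rewrite (Kclass_irr _ Hs) (Kclass_irr _ Hh).
rewrite (koszul_fold_class (KcplxP P) Hh Hs n1 (ct_mapP c)) agDBK.
by case: P {c Hh Hs} => P HP; exact: Kclass_irr.
Qed.

End Step.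

(** * Composition of steps and passage to the infinite range *)

Lemma Kmap_id n (nn : lei n n) : Kmap S nn =1 id.
Proof.
apply: (@Kgroup_ext n _ (Kmap S nn) (ah_id _)) => -[P HP]; rewrite KmapE.
exact: Kclass_irr.
Qed.

Lemma Kmap_comp k m n (km : lei k m) (mn : lei m n) (kn : lei k n) x :
  Kmap S mn (Kmap S km x) = Kmap S kn x.
Proof.
move: x; apply: (@Kgroup_ext k _ (ah_comp (Kmap S mn) (Kmap S km)) (Kmap S kn)) => P.
by rewrite ah_compE !KmapE; exact: Kclass_irr.
Qed.

Lemma Kmap_iso_fin (k j : nat) (kj : lei k (k + j)%N) : (0 < k)%N -> abIso (Kmap S kj).
Proof.
move=> k0; elim: j kj => [|j IH] kj.
  move: kj; rewrite addn0 => kj; exists (ah_id _).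
  by split=> x; exact: Kmap_id.
have kj' : lei k (k + j)%N by rewrite /= leq_addr.
have jj : lei (k + j)%N (k + j.+1)%N by rewrite /= leq_add2l.
apply: (@abIso_eq _ _ (ah_comp (Kmap S jj) (Kmap S kj'))).
  by move=> x; exact: Kmap_comp.
apply: abIso_comp (IH _) _; apply: Kmap_step => [|i /=].
  by rewrite /= ltn_addr.
by rewrite addnS ltnS.
Qed.

(** The inverse sends a bounded [P] to the element over range [k] whose image in range [k + j] is
    the class of [P] for all large [j]. *)
Lemma Kmap_iso_infty (k : nat) (kn : lei k Infty) : (0 < k)%N -> abIso (Kmap S kn).
Proof.
move=> k0.
have k_fin j : lei k (k + j)%N by rewrite /= leq_addr.
(* Asking for all [j] from [N] on lets the three complexes of a short exact sequence be compared at
   a common stage. *)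
pose lifts (P : cplx R) (x : Kgroup S k) :=
  exists N, forall j, (N <= j)%N -> exists H : Kcplx_spec S (k + j)%N P,
    Kmap S (k_fin j) x = K _ H.
have Kmap_inj j x y : Kmap S (k_fin j) x = Kmap S (k_fin j) y -> x = y.
  by have [g [gK _]] := Kmap_iso_fin (k_fin j) k0; exact: can_inj gK _ _.
have lift_ex (P : Kcplx S Infty) : exists x, lifts P x.
  have HP := KcplxP P; have [[N bP] _ fP pP lP] := HP.
  have Hj j : (N <= j)%N -> Kcplx_spec S (k + j)%N P.
    move=> Nj; split=> // [|i]; first by exists N.
    rewrite /= -ltnNge => ji; apply: bP; apply: leq_ltn_trans Nj _.
    by apply: leq_ltn_trans ji; exact: leq_addl.
  have [g [_ gK]] := Kmap_iso_fin (k_fin N) k0.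
  exists (g (K _ (Hj N (leqnn N)))), N => j Nj; exists (Hj j Nj).
  have Nj' : lei (k + N)%N (k + j)%N by rewrite /= leq_add2l.
  by rewrite -(Kmap_comp (k_fin N) Nj') gK KmapE; exact: Kclass_irr.
pose F (P : Kcplx S Infty) := sval (cid (lift_ex P)).
have FP (P : Kcplx S Infty) : lifts P (F P) := svalP (cid (lift_ex P)).
have Fexact (P' P P'' : Kcplx S Infty) (f : cmap P' P) (g : cmap P P'') :
    short_exact f g -> F P = agD (F P') (F P'').
  have [N' HN'] := FP P'; have [N HN] := FP P; have [N'' HN''] := FP P''.
  move=> fg; pose j := maxn N' (maxn N N'').
  have [|H' E'] := HN' j; first by rewrite leq_maxl.
  have [|H E] := HN j; first by rewrite /j maxnCA leq_maxl.
  have [|H'' E''] := HN'' j; first by rewrite /j maxnA leq_maxr.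
  by apply: (Kmap_inj j); rewrite ah_D E' E E''; exact: Kclass_exact fg.
have Facyclic (P : Kcplx S Infty) : acyclic P -> F P = ag0.
  move=> aP; have [N HN] := FP P; have [H E] := HN N (leqnn N).
  by apply: (Kmap_inj N); rewrite ah_0 E Kclass_acyclic.
exists (Kgroup_lift Fexact Facyclic); split.
  apply: (@Kgroup_ext k _ (ah_comp (Kgroup_lift Fexact Facyclic) (Kmap S kn)) (ah_id _)) => P.
  rewrite ah_compE KmapE Kgroup_liftE; have [N HN] := FP (Kincl kn P).
  have [H E] := HN N (leqnn N).
  by apply: (Kmap_inj N); rewrite E KmapE; exact: Kclass_irr.
apply: (@Kgroup_ext Infty _ (ah_comp (Kmap S kn) (Kgroup_lift Fexact Facyclic)) (ah_id _)) => P.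
rewrite ah_compE Kgroup_liftE; have [N HN] := FP P; have [H E] := HN N (leqnn N).
have Ninf : lei (k + N)%N Infty by [].
rewrite -(Kmap_comp (k_fin N) Ninf) E KmapE.
by case: P H {HN E} => P HP H; exact: Kclass_irr.
Qed.

End Kclasses.

Theorem theorem1p3 (R : comPzRingType) (S : mulrClosed R) (k n : natinf)
  (k_ge1 : lei (Fin 1) k) (k_le_n : lei k n) :
  abIso (Kmap S k_le_n).
Proof.
(* If [k] is infinite, then so is [n], and the map is the identity. *)
case: k n k_ge1 k_le_n => [k|] [n|] //= k1 kn; last 1 first.
- by exists (ah_id _); split=> x; exact: Kmap_id.
- by have e := subnKC kn; move: kn; rewrite -e => kn; exact: Kmap_iso_fin.
- exact: Kmap_iso_infty.
Qed.
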